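(* Let $\ell\ge 2$, let $V$ be a complex vector space of dimension $n$, and let $\theta=\det^{-1}$. If $n=\dim V\leq 3$, then the Nakajima quiver variety $\overline{\mathcal{M}}^{\theta}(n,\ell)$ has finitely many fixed points for the action of the torus $T=(\mathbb{C}^* )^{\ell}$.
   Context: Work over $\mathbb{C}$. Let $G=GL(V)$, $\mathfrak g=\mathfrak{gl}(V)$, $\dim V=n$, and $\overline{R}=\mathfrak{sl}(V)^{\oplus \ell}\oplus V^*$. Via the trace form, $T^*\overline{R}=\mathfrak{sl}(V)^{\oplus 2\ell}\oplus V^*\oplus V$, with elements written $(X_1,\dots,X_\ell,Y_1,\dots,Y_\ell,i,j)$, $i\in V^*=\mathrm{Hom}(V,\mathbb{C})$, $j\in V=\mathrm{Hom}(\mathbb{C},V)$. $G$ acts naturally (conjugation on the $X_k,Y_k$) with moment map $\mu=\sum_{k=1}^{\ell}[X_k,Y_k]-ji$. For the character $\theta=\det^{-1}$, a point is $\theta$-semistable iff no proper subspace of $V$ containing $\mathrm{im}\,j$ is stable under all $X_k,Y_k$. The quiver variety is the GIT quotient $\overline{\mathcal{M}}^{\theta}(n,\ell)=\mu^{-1}(0)^{\theta\text{-}ss}/\!/G$ (a free quotient, smooth and symplectic). The torus $T=(\mathbb{C}^* )^\ell$ acts by $(t_1,\dots,t_\ell)\cdot(X_k,Y_k,i,j)=(t_kX_k,t_k^{-1}Y_k,i,j)$, and this descends to $\overline{\mathcal{M}}^{\theta}(n,\ell)$. *)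

(* Defs.v *)
From HB Require Import structures.
From mathcomp Require Import all_boot all_order all_algebra.
From mathcomp Require Import boolp classical_sets functions cardinality reals.
From mathcomp Require Export complex.

Set Implicit Arguments.
Unset Strict Implicit.
Unset Printing Implicit Defensive.

Import GRing.Theory.
Local Open Scope classical_set_scope.
Local Open Scope ring_scope.

(* V = F^n is the space of column vectors, so that V^* = Hom(V, F) is the
   space of row vectors and endomorphisms of V act by left multiplication.
   [rep] is the cotangent bundle of V^* + gl(V)^l; the conditions cutting out
   T^*(V^* + sl(V)^l) are imposed by [cotangent] below. *)
Record rep (F : fieldType) (n l : nat) := Rep {
  repX : 'I_l -> 'M[F]_n;
  repY : 'I_l -> 'M[F]_n;
  repi : 'rV[F]_n;
  repj : 'cV[F]_n }.

Section QuiverVariety.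
Variables (F : fieldType) (n l : nat).
Implicit Types (p : rep F n l) (g : 'M[F]_n) (t : 'I_l -> F).

Definition cotangent : set (rep F n l) :=
  [set p | forall k, \tr (repX p k) = 0 /\ \tr (repY p k) = 0].

Definition moment p : 'M[F]_n :=
  \sum_(k < l) (repX p k *m repY p k - repY p k *m repX p k)
  - repj p *m repi p.

(* Semistability for theta = det^{-1}; im j is the line spanned by [repj p]. *)
Definition semistable p : Prop :=
  forall W : {vspace 'cV[F]_n},
    repj p \in W ->
    (forall k v, v \in W -> repX p k *m v \in W /\ repY p k *m v \in W) ->
    W = fullv.

Definition gl_act g p : rep F n l :=
  Rep (fun k => g *m repX p k *m invmx g) (fun k => g *m repY p k *m invmx g)
      (repi p *m invmx g) (g *m repj p).

Definition gl_orbit p : set (rep F n l) :=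
  [set gl_act g p | g in [set g | g \in unitmx]].

Definition semistable_zero_fiber : set (rep F n l) :=
  [set p | [/\ cotangent p, moment p = 0 & semistable p]].

(* GL(V) acts freely on the semistable locus ([gl_act_free]), so the points of
   the GIT quotient are exactly the GL(V)-orbits in that locus. *)
Definition quiver_variety : set (set (rep F n l)) :=
  gl_orbit @` semistable_zero_fiber.

Definition torus : set ('I_l -> F) := [set t | forall k, t k != 0].

Definition torus_act t p : rep F n l :=
  Rep (fun k => t k *: repX p k) (fun k => (t k)^-1 *: repY p k)
      (repi p) (repj p).

(* The action induced by [torus_act] on orbits, see [quiver_variety_torus]. *)
Definition quiver_torus_act t (O : set (rep F n l)) : set (rep F n l) :=
  torus_act t @` O.

Definition quiver_torus_fixed : set (set (rep F n l)) :=
  [set O | quiver_variety O /\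
           forall t, torus t -> quiver_torus_act t O = O].

Lemma rep_eq p q : repX p =1 repX q -> repY p =1 repY q ->
  repi p = repi q -> repj p = repj q -> p = q.
Proof.
case: p q => [X Y i j] [X' Y' i' j'] /= eX eY -> ->.
by rewrite (funext eX) (funext eY).
Qed.

Lemma gl_act_free p g :
  semistable p -> g \in unitmx -> gl_act g p = p -> g = 1%:M.
Proof.
move=> sp gu ep.
have eX := congr1 (@repX _ _ _) ep; have eY := congr1 (@repY _ _ _) ep.
have ej : g *m repj p = repj p := congr1 (@repj _ _ _) ep.
have comm A : g *m A *m invmx g = A -> g *m A = A *m g.
  by move=> eA; rewrite -[in RHS]eA mulmxKV.
pose h : 'M[F]_n := g - 1%:M.
have hW : lker (linfun (mulmx h : 'cV_n -> 'cV_n)) = fullv.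
  have commh A : g *m A *m invmx g = A -> h *m A = A *m h.
    by move=> /comm eA; rewrite mulmxBl mulmxBr eA mul1mx mulmx1.
  apply: sp.
  - by rewrite memv_ker lfunE /= mulmxBl mul1mx ej subrr.
  - move=> k v; rewrite !memv_ker !lfunE /= => /eqP hv.
    rewrite !mulmxA (commh _ (congr1 (@^~ k) eX)) (commh _ (congr1 (@^~ k) eY)).
    by rewrite -!mulmxA hv !mulmx0.
apply/eqP; rewrite -subr_eq0 -/h; apply/eqP/matrixP=> a b.
have : (delta_mx b 0 : 'cV_n) \in lker (linfun (mulmx h : 'cV_n -> 'cV_n)).
  by rewrite hW memvf.
rewrite memv_ker lfunE /= => /eqP; rewrite -colE => /matrixP/(_ a 0).
by rewrite !mxE.
Qed.

Lemma torus_gl_act t g p : torus_act t (gl_act g p) = gl_act g (torus_act t p).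
Proof. by apply: rep_eq => [k|k||] //=; rewrite -scalemxAr -scalemxAl. Qed.

Lemma quiver_torus_act_orbit t p :
  quiver_torus_act t (gl_orbit p) = gl_orbit (torus_act t p).
Proof.
apply/seteqP; split=> q.
- by move=> [_ [g gu <-] <-]; exists g; rewrite ?torus_gl_act.
- move=> [g gu <-]; exists (gl_act g p); last by rewrite torus_gl_act.
  by exists g.
Qed.

Lemma torus_semistable_zero_fiber t p : torus t ->
  semistable_zero_fiber p -> semistable_zero_fiber (torus_act t p).
Proof.
move=> t0 [cp mp sp]; split.
- by move=> k /=; have [trX trY] := cp k; rewrite !mxtraceZ trX trY !mulr0.
- rewrite -[RHS]mp /moment /=; congr (_ - _); apply: eq_bigr => k _.
  rewrite -!scalemxAl -!scalemxAr !scalerA.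
  by rewrite divff ?mulVf ?scale1r //; exact: t0.
- move=> W jW sW; apply: sp => // k v vW; have [XW YW] := sW k v vW.
  move: XW YW => /=; rewrite -!scalemxAl => XW YW; split.
    by rewrite -(scalerK (t0 k) (_ *m v)) rpredZ.
  by rewrite -(scalerKV (t0 k) (_ *m v)) rpredZ.
Qed.

Lemma quiver_variety_torus t (O : set (rep F n l)) : torus t ->
  quiver_variety O -> quiver_variety (quiver_torus_act t O).
Proof.
move=> t0 [p pss <-]; rewrite quiver_torus_act_orbit.
by exists (torus_act t p) => //; exact: torus_semistable_zero_fiber.
Qed.

End QuiverVariety.

Arguments quiver_torus_fixed : clear implicits.

(* Main.v *)
(* If the orbit of p is fixed, then t.p = g_t.p for some g_t in GL(V), and every
   word in the X_k, Y_k applied to j is an eigenvector of g_t. These words span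
   V by semistability, so for n <= 3 there is a basis made of the words 1, a and
   b or b a. The point t = (-1, ..., -1) and one t separating the arrows show
   that in this basis the only possibly nonzero matrix entries join a word to
   its parent, in either direction. Then tr mu = 0 (which gives i j = 0) and a
   suitable entry of mu force i = 0, and the diagonal entries of mu kill the
   entries going from a word to its parent. What remains is a point with all
   entries 0 or 1, and there are finitely many of those. *)
Require Import Defs.
From mathcomp Require Import all_boot all_order all_algebra.
From mathcomp Require Import boolp classical_sets functions cardinality reals.
Local Open Scope complex_scope.

Set Implicit Arguments.
Unset Strict Implicit.
Unset Printing Implicit Defensive.

Import Order.TTheory GRing.Theory Num.Theory.
Local Open Scope classical_set_scope.
Local Open Scope ring_scope.

(** * Words in the arrows, the moment map, and bases made of words *)

Section FieldLemmas.
Variables (F : fieldType) (n l : nat).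
Implicit Types (p q : rep F n l) (g h : 'M[F]_n) (t : 'I_l -> F).
Implicit Types (c : 'I_l * bool) (w : seq ('I_l * bool)).

Definition arrow p c : 'M[F]_n := if c.2 then repX p c.1 else repY p c.1.

Definition opp_arrow c := (c.1, ~~ c.2).

(** The head of the list is the arrow applied last, so the parent of a word is its tail. *)
Definition word p w : 'cV[F]_n := foldr (fun c v => arrow p c *m v) (repj p) w.

Definition weight t c : F := if c.2 then t c.1 else (t c.1)^-1.

Lemma arrow_gl_act g p c : arrow (gl_act g p) c = g *m arrow p c *m invmx g.
Proof. by rewrite /arrow; case: c.2. Qed.

Lemma arrow_torus_act t p c : arrow (torus_act t p) c = weight t c *: arrow p c.
Proof. by rewrite /arrow /weight; case: c.2. Qed.

Lemma opp_arrowK : involutive opp_arrow.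
Proof. by case=> k b; rewrite /opp_arrow /= negbK. Qed.

Lemma weight_opp t c : weight t (opp_arrow c) = (weight t c)^-1.
Proof. by rewrite /weight /=; case: c.2; rewrite /= ?invrK. Qed.

Lemma weight_neq0 t c : torus t -> weight t c != 0.
Proof. by move=> t0; rewrite /weight; case: c.2; rewrite ?invr_eq0. Qed.

Lemma gl_actM g h p : g \in unitmx -> h \in unitmx ->
  gl_act g (gl_act h p) = gl_act (g *m h) p.
Proof.
move=> gu hu; have inv_gh : invmx (g *m h) = invmx h *m invmx g.
  by rewrite -[RHS]mulmx1 -(mulmxV (_ : g *m h \in unitmx)) ?unitmx_mul ?gu //
     !mulmxA mulmxKV // mulVmx // mul1mx.
by apply: rep_eq => [k|k||] /=; rewrite ?inv_gh !mulmxA.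
Qed.

Lemma gl_orbit_gl_act g p : g \in unitmx -> gl_orbit (gl_act g p) = gl_orbit p.
Proof.
move=> gu; apply/seteqP; split=> q [h /= hu <-].
  by exists (h *m g); rewrite /= ?unitmx_mul ?hu ?gl_actM.
exists (h *m invmx g); first by rewrite /= unitmx_mul hu unitmx_inv.
by rewrite gl_actM ?mulmxKV // unitmx_mul hu unitmx_inv.
Qed.

Lemma word_gl_act g p w : g \in unitmx -> word (gl_act g p) w = g *m word p w.
Proof.
by move=> gu; elim: w => //= c w ->; rewrite arrow_gl_act -!mulmxA mulKmx.
Qed.

Lemma moment_gl_act g p : g \in unitmx ->
  moment (gl_act g p) = g *m moment p *m invmx g.
Proof.
move=> gu; rewrite /moment mulmxBr mulmxBl mulmx_sumr mulmx_suml /= !mulmxA.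
congr (_ - _); apply: eq_bigr => k _.
by rewrite mulmxBr mulmxBl !mulmxA !mulmxKV.
Qed.

Lemma momentE p :
  moment p = \sum_c (if c.2 then 1 else -1) *: (arrow p c *m arrow p (opp_arrow c))
             - repj p *m repi p.
Proof.
rewrite /moment -(pair_bigA _ (fun k b => (if b then 1 else -1) *:
  (arrow p (k, b) *m arrow p (opp_arrow (k, b))))) /=; congr (_ - _).
by apply: eq_bigr => k _; rewrite big_bool /= scale1r scaleN1r.
Qed.

(** Commutators are traceless, so tr(j i) = 0, and this trace is the scalar i j. *)
Lemma moment0_pairing p : moment p = 0 -> repi p *m repj p = 0.
Proof.
move=> /(congr1 mxtrace); rewrite mxtrace0 /moment raddfB raddf_sum big1 /=.
  by rewrite sub0r mxtrace_mulC => /eqP; rewrite oppr_eq0 trace_mx11 => /eqP e;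
     rewrite [LHS]mx11_scalar e; apply/matrixP=> r s; rewrite !mxE mul0rn.
by move=> k _; rewrite raddfB /= mxtrace_mulC subrr.
Qed.

(* The hypothesis says that [r <- m0 <- s] is the only path of length two. *)
Lemma moment0_path p c0 (r s m0 : 'I_n) :
  moment p = 0 -> repj p r 0 * repi p 0 s = 0 ->
  (forall c m, arrow p c r m != 0 -> arrow p (opp_arrow c) m s != 0 ->
     c = c0 /\ m = m0) ->
  arrow p c0 r m0 * arrow p (opp_arrow c0) m0 s = 0.
Proof.
move=> /matrixP/(_ r s) mp ji path.
have {}path c m : ~~ ((c == c0) && (m == m0)) ->
    arrow p c r m * arrow p (opp_arrow c) m s = 0.
  move=> cm; apply/eqP; rewrite mulf_eq0; apply: contraNT cm.
  by rewrite negb_or => /andP[A1 A2]; have [-> ->] := path c m A1 A2; rewrite !eqxx.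
move: mp; rewrite momentE !mxE big_ord1 ji subr0 summxE.
rewrite (bigD1 c0) //= [X in _ + X]big1 => [|c cc0]; last first.
  by rewrite !mxE big1 ?mulr0 // => m _; rewrite path // (negPf cc0).
rewrite addr0 !mxE (bigD1 m0) //= [X in _ + X]big1 => [|m mm0]; last first.
  by rewrite path // (negPf mm0) andbF.
rewrite addr0 => /eqP; rewrite mulf_eq0 => /orP[|/eqP//].
by case: c0.2; rewrite ?oppr_eq0 oner_eq0.
Qed.

(** Otherwise the span of the words would contain j and be stable under all arrows, hence be V,
    although its dimension is less than n. *)
Lemma semistable_extend p (ws : seq (seq ('I_l * bool))) :
  semistable p -> [::] \in ws -> (size ws < n)%N ->
  exists c w, w \in ws /\ word p (c :: w) \notin <<map (word p) ws>>%VS.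
Proof.
move=> sp ws0 szws; apply: contrapT => H.
have stab c w : w \in ws -> word p (c :: w) \in <<map (word p) ws>>%VS.
  by move=> wws; apply/negPn/negP => Hw; apply: H; exists c, w.
have stabv c v : v \in <<map (word p) ws>>%VS ->
    arrow p c *m v \in <<map (word p) ws>>%VS.
  move=> vW.
  suff /subvP/(_ v vW) : (<<map (word p) ws>> <=
      linfun (mulmx (arrow p c) : 'cV_n -> 'cV_n) @^-1: <<map (word p) ws>>)%VS.
    by rewrite -memv_preim lfunE.
  apply/span_subvP => _ /mapP[w wws ->].
  by rewrite -memv_preim lfunE /=; exact: stab.
have /(congr1 (@dimv _ _)) : <<map (word p) ws>>%VS = fullv.
  apply: sp; first by apply/memv_span/mapP; exists [::].
  by move=> k v vW; split; [exact: (stabv (k, true))|exact: (stabv (k, false))].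
rewrite dimvf /dim /= muln1 => e.
by have := dim_span (map (word p) ws); rewrite e size_map leqNgt szws.
Qed.

Lemma free_rcons (vT : vectType F) (X : seq vT) v :
  free (rcons X v) = (v \notin <<X>>%VS) && free X.
Proof. by rewrite (perm_free (Y := v :: X)) ?perm_rcons // free_cons. Qed.

Lemma free_basis_unitmx (X : n.-tuple 'cV[F]_n) :
  free X -> (\matrix_(r, s) tnth X s r 0) \in unitmx.
Proof.
(* After transposing, a kernel row vector is the coefficient vector of a linear relation in [X]. *)
move=> /freeP fX; rewrite unitmxE unitfE -det_tr; apply/negP => /det0P[v v0 vX].
case/negP: v0; apply/eqP/rowP => s; rewrite mxE; apply: fX.
apply/colP => r; rewrite mxE summxE.
move: vX => /rowP/(_ r); rewrite !mxE => e; rewrite -[RHS]e; apply: eq_bigr => k _.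
by rewrite !mxE (tnth_nth 0).
Qed.

Lemma word_frame p (ws : n.-tuple (seq ('I_l * bool))) :
  free (map (word p) ws) ->
  exists2 g, g \in unitmx &
    forall r, word (gl_act g p) (tnth ws r) = delta_mx r 0.
Proof.
move=> fws; have Pu := @free_basis_unitmx (map_tuple (word p) ws) fws.
set P := (X in X \in _) in Pu.
exists (invmx P) => [|r]; first by rewrite unitmx_inv.
rewrite word_gl_act ?unitmx_inv //; apply: (canLR (mulKmx Pu)).
by rewrite -colE; apply/colP => s; rewrite !mxE tnth_map.
Qed.

(** The torus leaves j unchanged, so only the letters of the word contribute a weight. *)
Lemma word_torus t g p w : g \in unitmx -> gl_act g p = torus_act t p ->
  g *m word p w = (\prod_(c <- w) weight t c) *: word p w.
Proof.
move=> gu e; rewrite -word_gl_act // e; elim: w => [|c w /= ->].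
  by rewrite big_nil scale1r.
by rewrite big_cons arrow_torus_act -scalemxAl -scalemxAr scalerA.
Qed.

(** * Torus weights at a fixed point, in a basis of words *)

Definition torus_fixed p := forall t, torus t ->
  exists2 g, g \in unitmx & gl_act g p = torus_act t p.

Definition word_framed p (ws : n.-tuple (seq ('I_l * bool))) :=
  forall r, word p (tnth ws r) = delta_mx r 0.

Section Framed.
Variables (p : rep F n l) (ws : n.-tuple (seq ('I_l * bool))).
Hypotheses (fp : torus_fixed p) (wp : word_framed p ws).

Let framed_diag t g : g \in unitmx -> gl_act g p = torus_act t p ->
  g = diag_mx (\row_r \prod_(c <- tnth ws r) weight t c).
Proof.
move=> gu e; apply/matrixP => r s.
have := word_torus (tnth ws s) gu e; rewrite wp -colE => /colP/(_ r).
rewrite !mxE eqxx andbT => ->.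
by rewrite mulr_natr; case: eqP => // ->.
Qed.

(** In the basis of words g is diagonal. Compare the (r, s) entries of g A and [weight t c] A g,
    where A is the arrow, and cancel the nonzero entry of A. *)
Lemma framed_arrow_weight t c r s : torus t -> arrow p c r s != 0 ->
  \prod_(d <- tnth ws r) weight t d = weight t c * \prod_(d <- tnth ws s) weight t d.
Proof.
move=> t0 A0; have [g gu e] := fp t0; have gE := framed_diag gu e.
have /matrixP/(_ r s) : g *m arrow p c = weight t c *: arrow p c *m g.
  by rewrite -arrow_torus_act -e arrow_gl_act mulmxKV.
rewrite gE mul_diag_mx mul_mx_diag !mxE mulrAC => /(mulIf A0) //.
Qed.

Lemma framed_repi_weight t s : torus t -> repi p 0 s != 0 ->
  \prod_(d <- tnth ws s) weight t d = 1.
Proof.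
move=> t0 i0; have [g gu e] := fp t0; have gE := framed_diag gu e.
have /rowP/(_ s) : repi p = repi p *m g.
  by rewrite -[in RHS](congr1 (@repi _ _ _) e) /= mulmxKV.
rewrite gE mul_mx_diag !mxE -[LHS]mulr1 => /(mulfI i0) //.
Qed.

End Framed.

End FieldLemmas.

(** * Fixed points framed by a tree of short words *)

Section WordTree.
Variables (F : numFieldType) (n l : nat).
Implicit Types (p : rep F n l) (c d : 'I_l * bool) (w : seq ('I_l * bool)).

Lemma torusN1 : torus (fun _ : 'I_l => -1 : F).
Proof. by move=> k; rewrite oppr_eq0 oner_eq0. Qed.

Lemma weightN1 c : weight (fun _ => -1 : F) c = -1.
Proof. by rewrite /weight invrN1 if_same. Qed.

Lemma prod_weightN1 w :
  \prod_(c <- w) weight (fun _ => -1 : F) c = (-1) ^+ odd (size w).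
Proof.
elim: w => [|c w IH]; first by rewrite big_nil.
by rewrite big_cons IH weightN1 /= signrN mulN1r.
Qed.

(** A point at which all 2l arrows have distinct weights. The exponent starts at 1 because X_0 and
    Y_0 would both have weight 1 if it started at 0. *)
Definition pow2_torus (k : 'I_l) : F := 2 ^+ k.+1.

Lemma torus_pow2 : torus pow2_torus.
Proof. by move=> k; rewrite expf_neq0 // pnatr_eq0. Qed.

Lemma weight_pow2_inj : injective (weight pow2_torus).
Proof.
have pow2_inj a b : (2 ^+ a = 2 ^+ b :> F) -> a = b.
  by move=> /eqP; rewrite -!natrX eqr_nat eqn_exp2l // => /eqP.
have pow2_neqV a b : (2 ^+ a.+1 : F) <> (2 ^+ b.+1)^-1.
  move=> e; suff /(@pow2_inj _ 0) : (2 ^+ (a.+1 + b.+1) = 2 ^+ 0 :> F) by [].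
  by rewrite exprD e mulVf // expf_neq0 // pnatr_eq0.
move=> [k [|]] [k' [|]]; rewrite /weight /pow2_torus //=.
- by move=> /pow2_inj[/ord_inj->].
- by move=> /pow2_neqV.
- by move=> /esym/pow2_neqV.
- by move=> /invr_inj/pow2_inj[/ord_inj->].
Qed.

Section Framed.
Variables (p : rep F n l) (ws : n.-tuple (seq ('I_l * bool))).
Hypotheses (fp : torus_fixed p) (wp : word_framed p ws).
Hypothesis mp : moment p = 0.
Hypothesis ws0 : [::] \in ws.
Hypothesis ws_suffix : forall c w, c :: w \in ws -> w \in ws.
Hypothesis ws_adjacent : forall w w', w \in ws -> w' \in ws ->
  odd (size w) != odd (size w') ->
  (exists d, w = d :: w') \/ (exists d, w' = d :: w).
Hypothesis ws_size : forall w, w \in ws -> (size w <= 2)%N.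

Lemma framed_inj : injective (tnth ws).
Proof.
move=> r s e; have := wp s; rewrite -e wp => /colP/(_ r); rewrite !mxE !eqxx !andbT.
by case: eqP => // _ /eqP; rewrite oner_eq0.
Qed.

Lemma framed_arrow_child c r s s' :
  tnth ws r = c :: tnth ws s -> arrow p c s' s = (s' == r)%:R.
Proof.
move=> e; have := wp r; rewrite e /= -/(word _ _) wp -colE => /colP/(_ s').
by rewrite !mxE andbT.
Qed.

Lemma framed_repj s : repj p s 0 = (tnth ws s == [::])%:R.
Proof.
have /tnthP[r er] := ws0; have := wp r; rewrite -er /= => ->.
by rewrite mxE andbT -(inj_eq framed_inj) -er.
Qed.

(** At t = (-1, ..., -1) every arrow has weight -1, so the two words have lengths of opposite parity
    and are parent and child. The weights at [pow2_torus] then identify the letter joining them. *)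
Lemma framed_arrow_neq0 c r s : arrow p c r s != 0 ->
  tnth ws r = c :: tnth ws s \/ tnth ws s = opp_arrow c :: tnth ws r.
Proof.
move=> A0.
have : odd (size (tnth ws r)) != odd (size (tnth ws s)).
  apply/eqP => e; have := framed_arrow_weight fp wp torusN1 A0.
  rewrite !prod_weightN1 weightN1 e => /eqP; rewrite mulN1r -addr_eq0 -mulr2n.
  by rewrite mulrn_eq0 /= signr_eq0.
have := framed_arrow_weight fp wp torus_pow2 A0.
have P0 w : \prod_(d <- w) weight pow2_torus d != 0.
  elim/big_rec: _ => [|d x _ x0]; first exact: oner_neq0.
  by rewrite mulf_neq0 // (weight_neq0 _ torus_pow2).
move=> W /ws_adjacent[]; rewrite ?mem_tnth // => -[d e].
  left; move: W; rewrite e big_cons => /(mulIf (P0 _))/weight_pow2_inj -> //.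
right; move: W; rewrite e big_cons mulrA -{1}[X in X = _]mul1r.
move=> /(mulIf (P0 _)) /esym W; congr (_ :: _).
apply: weight_pow2_inj; rewrite weight_opp; apply: (@mulfI _ (weight pow2_torus c)).
  exact/weight_neq0/torus_pow2.
by rewrite W divff //; exact/weight_neq0/torus_pow2.
Qed.

Lemma framed_repi0 : repi p = 0.
Proof.
(* As j is the basis vector of the empty word, this entry of i is the scalar i j. *)
have root_i s : tnth ws s = [::] -> repi p 0 s = 0.
  move=> es; have /rowP/(_ 0) := moment0_pairing mp.
  rewrite !mxE (bigD1 s) //= big1 => [|r rs].
    by rewrite framed_repj es eqxx mulr1 addr0.
  by rewrite framed_repj -es (inj_eq framed_inj) (negPf rs) mulr0.
apply/rowP => s; rewrite mxE; apply/eqP/negPn/negP => i0.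
have := framed_repi_weight fp wp torusN1 i0.
have := framed_repi_weight fp wp torus_pow2 i0.
have := ws_size (mem_tnth s ws); have := mem_tnth s ws.
case es: (tnth ws s) => [|b [|a [|//]]] + _; first by move: i0; rewrite root_i ?eqxx.
  rewrite prod_weightN1 expr1 => _ _ /eqP; rewrite eq_sym -addr_eq0 -mulr2n.
  by rewrite pnatr_eq0.
move=> ws_ba; rewrite big_cons big_seq1 => W _.
(* The word b a has weight 1 at [pow2_torus], so its two letters have inverse weights. *)
have {W}eb : a = opp_arrow b.
  apply: weight_pow2_inj; rewrite weight_opp.
  by rewrite -[LHS](mulKf (weight_neq0 b torus_pow2)) W mulr1.
have /tnthP[m em] := ws_suffix ws_ba; have /tnthP[r er] := ws0.
(* The entry of mu from the empty word to b a is, up to sign, a single product of arrow entries. The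
   framing makes this product 1, contradicting mu = 0. *)
suff : arrow p b s m * arrow p (opp_arrow b) m r = 0.
  rewrite (@framed_arrow_child b s m) -?em // -eb (@framed_arrow_child a m r) -?em -?er //.
  by rewrite !eqxx mulr1 => /eqP; rewrite oner_eq0.
apply: moment0_path => // [|c m' /framed_arrow_neq0[] + _].
- by rewrite framed_repj es mul0r.
- by rewrite es em => -[-> /framed_inj->].
- move=> e; have := ws_size (mem_tnth m' ws); by rewrite e es.
Qed.

Lemma framed_arrow_down d r s :
  tnth ws s = d :: tnth ws r -> arrow p (opp_arrow d) r s = 0.
Proof.
(* Pruning leaves: in entry (s, s) of the moment map, the loops through the
   children of s vanish by induction, leaving the loop through its parent. *)
have [k] := ubnP (2 - size (tnth ws s)); elim: k d r s => // k IH d r s szs e.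
suff : arrow p d s r * arrow p (opp_arrow d) r s = 0.
  by rewrite (framed_arrow_child _ e) eqxx mul1r.
apply: moment0_path => // [|c m A0 _]; first by rewrite framed_repi0 mxE mulr0.
have [|em] := framed_arrow_neq0 A0; first by rewrite e => -[-> /framed_inj->].
have szm : (size (tnth ws s) < 2)%N by have := ws_size (mem_tnth m ws); rewrite em.
move: A0; rewrite -[c]opp_arrowK (IH _ _ _ _ em) ?eqxx //.
by rewrite em /= subnSK.
Qed.

(** Entries towards a child are 1 by the framing; those towards the parent vanish. *)
Lemma framed_arrow01 c r s : arrow p c r s = (arrow p c r s != 0)%:R.
Proof.
have [->|A0] := eqVneq (arrow p c r s) 0; first by [].
have [e|e] := framed_arrow_neq0 A0; first by rewrite (framed_arrow_child _ e) eqxx.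
by move: A0; rewrite -{1}[c]opp_arrowK (framed_arrow_down e) eqxx.
Qed.

End Framed.
End WordTree.

(** * Existence of the tree of words, and finiteness *)

Section Finiteness.
Variables (F : numFieldType) (n l : nat).
Implicit Types (p q : rep F n l) (ws : seq (seq ('I_l * bool))).

(** The last two clauses hold for any suffix-closed set of at most three words, which is how n <= 3
    enters. The parity clause fails for 1, a, b, c a with a and b distinct. *)
Definition word_tree ws :=
  [/\ [::] \in ws, forall c w, c :: w \in ws -> w \in ws,
   forall w w', w \in ws -> w' \in ws -> odd (size w) != odd (size w') ->
     (exists d, w = d :: w') \/ (exists d, w' = d :: w) &
   forall w, w \in ws -> (size w <= 2)%N].

Lemma word_tree_basis p : (0 < n <= 3)%N -> semistable p ->
  exists ws, [/\ size ws = n, word_tree ws & free (map (word p) ws)].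
Proof.
move=> /andP[n0 n3] sp.
have tree0 : word_tree [:: [::]].
  by split=> // [w w'|w]; rewrite !inE => /eqP->// /eqP->.
(* If j were 0, the zero subspace would contradict semistability, as n > 0. *)
have free0 : free (map (word p) [:: [::]]).
  rewrite /= free_cons nil_free andbT span_nil memv0; apply/negP => /eqP j0.
  have /(congr1 (@dimv _ _)) : (0%VS : {vspace 'cV[F]_n}) = fullv.
    apply: sp => [|k v]; rewrite !memv0 ?j0 // => /eqP->.
    by rewrite !mulmx0 !eqxx.
  by rewrite dimv0 dimvf /dim /= muln1 => e; rewrite -e in n0.
have [n1|n1] := eqVneq n 1%N; first by exists [:: [::]]; split; rewrite // n1.
have {n0 n1} n2 : (1 < n)%N by rewrite ltn_neqAle eq_sym n1.
have [a [w []]] := semistable_extend sp (mem_head [::] [::]) n2.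
rewrite inE => /eqP-> na; have tree1 : word_tree [:: [::]; [:: a]].
  split=> // [c w'|w' w''|w']; rewrite !inE.
  - by move=> /eqP[_ ->].
  - by move=> /orP[]/eqP-> /orP[]/eqP-> //= _; [right|left]; exists a.
  - by move=> /orP[]/eqP->.
have free1 : free (map (word p) [:: [::]; [:: a]]).
  by rewrite -[X in free X]/(rcons [:: _] _) free_rcons na.
have [e2|e2] := eqVneq n 2%N; first by exists [:: [::]; [:: a]]; split; rewrite // e2.
have e3 : n = 3%N by apply/eqP; rewrite eqn_leq n3 ltn_neqAle eq_sym e2.
have lt2 : (size [:: [::]; [:: a]] < n)%N by rewrite e3.
(* The word [u] is empty or a, which gives the two shapes 1, a, b and 1, a, b a. *)
have [b [u []]] := semistable_extend sp (mem_head _ _) lt2.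
move=> uws nb; exists (rcons [:: [::]; [:: a]] (b :: u)); split; first by rewrite e3.
  move: uws; rewrite !inE => uws /=; split=> // [c w'|w' w''|w']; rewrite !inE.
  - move=> /or3P[//|/eqP[_ ->]|/eqP[_ ->]]; first by rewrite eqxx.
    by case/orP: uws => ->; rewrite ?orbT.
  - by case/orP: uws => /eqP-> /or3P[]/eqP-> /or3P[]/eqP-> //= _;
       first [by left; eexists | by right; eexists].
  - by case/orP: uws => /eqP-> /or3P[]/eqP->.
by rewrite map_rcons free_rcons nb.
Qed.

Lemma fixed_orbit p : gl_orbit p \in quiver_torus_fixed F n l -> torus_fixed p.
Proof.
rewrite inE => -[_ fO] t t0; have /seteqP[sub _] := fO t t0.
have : gl_orbit p (torus_act t p).
  apply: sub; exists p => //; exists 1%:M; first exact: unitmx1.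
  by apply: rep_eq => [k|k||] /=; rewrite ?invmx1 ?mulmx1 ?mul1mx.
by case=> g; exists g.
Qed.

(** The parameter lives in a finite type, so the range is finite. *)
Definition rep01 (x : {ffun 'I_l * bool -> 'M[bool]_n} * 'cV[bool]_n) : rep F n l :=
  let toF (b : bool) : F := b%:R in
  Rep (fun k => map_mx toF (x.1 (k, true))) (fun k => map_mx toF (x.1 (k, false)))
      0 (map_mx toF x.2).

Lemma rep01P p : (forall c r s, arrow p c r s = (arrow p c r s != 0)%:R) ->
  repi p = 0 -> (forall r, repj p r 0 = (repj p r 0 != 0)%:R) ->
  exists x, rep01 x = p.
Proof.
move=> A01 i0 j01.
exists ([ffun c => map_mx (fun a => a != 0) (arrow p c)],
        map_mx (fun a => a != 0) (repj p)).
apply: rep_eq => [k|k||] /=; rewrite ?ffunE ?i0 //; apply/matrixP => r s; rewrite !mxE.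
- by rewrite -(A01 (k, true)).
- by rewrite -(A01 (k, false)).
- by rewrite ord1 -j01.
Qed.

Lemma quiver_torus_fixed_rep01 : (n <= 3)%N ->
  quiver_torus_fixed F n l `<=` @gl_orbit F n l @` range rep01.
Proof.
move=> n3 O OF; have [[p [cp mp sp] pO] _] := OF.
suff [g gu [x xE]] : exists2 g, g \in unitmx & exists x, rep01 x = gl_act g p.
  by exists (rep01 x); [exists x|rewrite xE gl_orbit_gl_act].
(* A word tree contains the empty word, so n = 0 is treated apart; there all matrices are empty. *)
have [n0|n0] := posnP n.
  have I0 (r : 'I_n) : False by case: r => r; rewrite n0.
  exists 1%:M; first exact: unitmx1.
  by apply: rep01P => [c r||r]; [case: (I0 r)|apply/rowP => s; case: (I0 s)|case: (I0 r)].
have [ws [/eqP sz [ws0 ws_suffix ws_adj ws_sz] fws]] :=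
  word_tree_basis (introT andP (conj n0 n3)) sp.
pose wt := Tuple sz.
have [g gu wg] := word_frame (ws := wt) fws.
have fg : torus_fixed (gl_act g p).
  by apply: fixed_orbit; rewrite gl_orbit_gl_act // pO inE.
have mg : moment (gl_act g p) = 0 by rewrite moment_gl_act // mp mulmx0 mul0mx.
exists g => //; apply: rep01P.
- exact: (framed_arrow01 fg wg mg).
- exact: (framed_repi0 fg wg mg).
- by move=> r; rewrite (framed_repj wg) //; case: eqP; rewrite ?oner_eq0 ?eqxx.
Qed.

End Finiteness.

Theorem theorem2p3 (R : realType) (n l : nat) (l_ge2 : (2 <= l)%N)
    (n_le3 : (n <= 3)%N) :
  finite_set (quiver_torus_fixed R[i] n l).
Proof.
apply: sub_finite_set (quiver_torus_fixed_rep01 n_le3) _.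
exact/finite_image/finite_image/finite_finset.
Qed.
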